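(* Let $r\ge 1$. For integers $l,q\ge 1$ let $a_{r,l,q}$ be the number of paths of length $l$ in the automaton $A_r$ that start at the start state $S$, end at an accept state, use no self-loop transition, and pass through exactly $q$ states carrying a self-loop. Let $P_r(x)$ be the polynomial in $x$ defined by $$P_r(x)=\sum_{l,q\ge 1} a_{r,l,q}\binom{x-l+q-1}{q-1}.$$ Then $P_r(x)$ has degree $2r-2$. Moreover, let $N_{r,k}$ be the number of Baxter matrices of size $r\times k$. Then for all integers $k\ge 2r-1$ we have $N_{r,k}=P_r(k)$.
   Context: **Baxter matrices.** Let $M$ be an $r\times k$ matrix of 0s and 1s. For $1\le x\le r-1$, $1\le y\le k-1$, the clockwise pinwheel of index $(x,y)$ has four segments of entries: $A_{x,y}=\{M[i,y+1]:1\le i\le x\}$, $B_{x,y}=\{M[x,i]:1\le i\le y\}$, $C_{x,y}=\{M[x+1,i]:y+1\le i\le k\}$, $D_{x,y}=\{M[i,y]:x+1\le i\le r\}$. The counterclockwise pinwheel of index $(x,y)$ has four segments: $A'_{x,y}=\{M[i,y]:1\le i\le x\}$, $B'_{x,y}=\{M[x+1,i]:1\le i\le y\}$, $C'_{x,y}=\{M[x,i]:y+1\le i\le k\}$, $D'_{x,y}=\{M[i,y+1]:x+1\le i\le r\}$. $M$ is a Baxter matrix if every row contains at least one 1, every column contains at least one 1, and for every clockwise and every counterclockwise pinwheel at least one of its four segments contains only 0s. **The automaton $A_r$.** It reads the columns of a 0-1 matrix with $r$ rows from left to right. Its states are a start state $S$ together with all $s=(s_1,\dots,s_r)\in\{1,2,3,4\}^r$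 having at least one entry equal to 1 (so there are $4^r-3^r$ non-start states). The entry $s_i$ is the rowstate of row $i$: 1 means the row has a 1 in the most recent column; 2 means the row contains only 0s up to now; 3 means the row must contain only 0s from the most recent column onward (because an earlier pinwheel depends on it); 4 means the row has a 0 in the most recent column but is not in rowstate 2 or 3. The column corresponding to a non-start state $s$ is the 0-1 column with 1s exactly in the rows $c(s)=\{i:s_i=1\}$. The input symbols are the nonzero 0-1 columns of height $r$, identified with nonempty sets $c'\subseteq\{1,\dots,r\}$ (the rows containing a 1). Transitions from $S$: reading $c'$ leads to the state $s'$ with $s'_i=1$ for $i\in c'$ and $s'_i=2$ for $i\notin c'$. Transitions from a non-start state $s$ with $c=c(s)$, reading $c'$: let $F\subseteq\{1,\dots,r\}$ be the set consisting of - all $i$ with $s_i=3$; - all $x+1$ with $1\le x\le r-1$ such that $c'$ contains some $i\le x$, $s_x\ne 2$, and $c$ contains some $i\ge x+1$ (the clockwise pinwheel is not satisfied by its segments $A,B,D$, so it forces row $x+1$ to be 0 from now on); - all $x$ with $1\le x\le r-1$ such that $c$ contains some $i\le x$, $s_{x+1}\neq 2$, and $c'$ contains some $i\ge x+1$ (the counterclockwise pinwheel is not satisfied by $A',B',D'$, so it forces row $x$ to be 0 from now on). If $F\cap c'\ne\emptyset$ or some $i\in F$ has $s_i=2$, there is no transition (the input is rejected). Otherwise there is a transition from $s$ to $s'$, where $s'_i=1$ if $i\in c'$; $s'_i=3$ if $i\in F$; $s'_i=2$ if $i\notin c'$ and $s_i=2$; and $s'_i=4$ in all remaining cases. The accept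 states are the non-start states with no entry equal to 2. A self-loop is a transition from a state to itself, and a state carries a self-loop if such a transition exists at it. The length of a path is its number of transitions. Only finitely many paths starting at $S$ avoid self-loops, so only finitely many of the numbers $a_{r,l,q}$ are nonzero. For a nonnegative integer $n$, $\binom{z}{n}=z(z-1)\cdots(z-n+1)/n!$ is regarded as a polynomial in $z$. *)

(* Defs.v *)
(* MathComp, with the finitely supported sums of MathComp-Analysis' classical
   layer.  Rows and columns are indexed from 0. *)
From HB Require Import structures.
(* In this order set0 and [set x | P] are those of finset by default. *)
From mathcomp Require Import classical_sets fsbigop.
From mathcomp Require Import all_boot all_order all_algebra.

Set Implicit Arguments.
Unset Strict Implicit.
Unset Printing Implicit Defensive.

Import GRing.Theory Num.Theory.

(* In both pinwheels x' and y' stand for x + 1 and y + 1; the four clauses are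
   the segments A, B, C, D (resp. A', B', C', D'). *)
Definition cw_pinwheel_ok (r k : nat) (M : 'M[bool]_(r, k))
    (x x' : 'I_r) (y y' : 'I_k) : bool :=
  [|| [forall i : 'I_r, (i <= x) ==> ~~ M i y'],
      [forall j : 'I_k, (j <= y) ==> ~~ M x j],
      [forall j : 'I_k, (y' <= j) ==> ~~ M x' j]
    | [forall i : 'I_r, (x' <= i) ==> ~~ M i y]].

Definition ccw_pinwheel_ok (r k : nat) (M : 'M[bool]_(r, k))
    (x x' : 'I_r) (y y' : 'I_k) : bool :=
  [|| [forall i : 'I_r, (i <= x) ==> ~~ M i y],
      [forall j : 'I_k, (j <= y) ==> ~~ M x' j],
      [forall j : 'I_k, (y' <= j) ==> ~~ M x j]
    | [forall i : 'I_r, (x' <= i) ==> ~~ M i y']].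

Definition baxter_matrix (r k : nat) (M : 'M[bool]_(r, k)) : bool :=
  [&& [forall i : 'I_r, exists j : 'I_k, M i j],
      [forall j : 'I_k, exists i : 'I_r, M i j]
    & [forall x : 'I_r, forall x' : 'I_r, forall y : 'I_k, forall y' : 'I_k,
        ((x' == x.+1 :> nat) && (y' == y.+1 :> nat)) ==>
        (cw_pinwheel_ok M x x' y y' && ccw_pinwheel_ok M x x' y y')]].

Definition baxter_count (r k : nat) : nat :=
  #|[set M : 'M[bool]_(r, k) | baxter_matrix M]|.

(* RS1, RS2, RS3, RS4 are the rowstates 1, 2, 3, 4. *)
Inductive rowstate := RS1 | RS2 | RS3 | RS4.

Definition rowstate_code (t : rowstate) : bool * bool :=
  match t with
  | RS1 => (false, false)
  | RS2 => (false, true)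
  | RS3 => (true, false)
  | RS4 => (true, true)
  end.

Definition rowstate_decode (b : bool * bool) : rowstate :=
  match b with
  | (false, false) => RS1
  | (false, true) => RS2
  | (true, false) => RS3
  | (true, true) => RS4
  end.

Lemma rowstate_codeK : cancel rowstate_code rowstate_decode.
Proof. by case. Qed.

HB.instance Definition _ := Equality.copy rowstate (can_type rowstate_codeK).
HB.instance Definition _ := Choice.copy rowstate (can_type rowstate_codeK).
HB.instance Definition _ := Countable.copy rowstate (can_type rowstate_codeK).
HB.instance Definition _ := Finite.copy rowstate (can_type rowstate_codeK).

Definition nonstart (r : nat) :=
  {s : {ffun 'I_r -> rowstate} | [exists i, s i == RS1]}.

(* None is the start state S. *)
Definition state (r : nat) := option (nonstart r).

Definition symbol (r : nat) := {c : {set 'I_r} | c != set0}.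

Definition column (r : nat) (s : {ffun 'I_r -> rowstate}) : {set 'I_r} :=
  [set i | s i == RS1].

(* The set F: in the second clause i is row x + 1, in the third i is row x. *)
Definition forced (r : nat) (s : {ffun 'I_r -> rowstate}) (c' : {set 'I_r}) :
    {set 'I_r} :=
  let c := column s in
  [set i : 'I_r |
    [|| s i == RS3,
        [exists x : 'I_r,
          [&& i == x.+1 :> nat, [exists j in c', j <= x], s x != RS2
            & [exists j in c, i <= j]]]
      | [exists y : 'I_r,
          [&& y == i.+1 :> nat, [exists j in c, j <= i], s y != RS2
            & [exists j in c', y <= j]]]]].

Definition start_target (r : nat) (c' : {set 'I_r}) : {ffun 'I_r -> rowstate} :=
  [ffun i => if i \in c' then RS1 else RS2].

Definition step_target (r : nat) (s : {ffun 'I_r -> rowstate})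
    (c' : {set 'I_r}) : {ffun 'I_r -> rowstate} :=
  [ffun i => if i \in c' then RS1
             else if i \in forced s c' then RS3
             else if s i == RS2 then RS2
             else RS4].

Definition rejected (r : nat) (s : {ffun 'I_r -> rowstate})
    (c' : {set 'I_r}) : bool :=
  (forced s c' :&: c' != set0) || [exists i in forced s c', s i == RS2].

(* The targets have value RS1 on the nonempty set c', so they always are
   non-start states. *)
Lemma start_target_nonstart (r : nat) (c' : symbol r) :
  [exists i, start_target (val c') i == RS1].
Proof.
case: c' => c' /= /set0Pn[i ic]; apply/existsP; exists i.
by rewrite ffunE ic.
Qed.

Lemma step_target_nonstart (r : nat) (s : {ffun 'I_r -> rowstate})
    (c' : symbol r) : [exists i, step_target s (val c') i == RS1].
Proof.
case: c' => c' /= /set0Pn[i ic]; apply/existsP; exists i.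
by rewrite ffunE ic.
Qed.

(* The outer None means that there is no transition. *)
Definition transition (r : nat) (s : state r) (c' : symbol r) :
    option (state r) :=
  match s with
  | None => Some (Some (Sub (start_target (val c')) (start_target_nonstart c')
                        : nonstart r))
  | Some s =>
      if rejected (val s) (val c') then None
      else Some (Some (Sub (step_target (val s) (val c'))
                           (step_target_nonstart (val s) c') : nonstart r))
  end.

Definition accept (r : nat) (s : state r) : bool :=
  if s is Some t then [forall i, val t i != RS2] else false.

Definition has_self_loop (r : nat) (s : state r) : bool :=
  [exists c' : symbol r, transition s c' == Some s].

(* A path is the sequence of its transitions, each given by its input symbol
   and its target; its source is the preceding target. *)
Fixpoint automaton_path (r : nat) (s : state r) (p : seq (symbol r * state r)) :
    bool :=
  if p is (c', t) :: p' then
    (transition s c' == Some t) && automaton_path t p'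
  else true.

Definition states_from_start (r : nat) (p : seq (symbol r * state r)) :
    seq (state r) :=
  None :: [seq e.2 | e <- p].

Definition no_self_loop_used (r : nat) (p : seq (symbol r * state r)) : bool :=
  sorted (fun s t : state r => s != t) (states_from_start p).

(* p has one item per transition, so that l is the length of the path; the
   visited states include the start state and the last one. *)
Definition path_count (r l q : nat) : nat :=
  #|[set p : l.-tuple (symbol r * state r) |
      [&& automaton_path None p,
          no_self_loop_used p,
          accept (last None (states_from_start p))
        & #|[set s in states_from_start p | has_self_loop s]| == q]]|.

Local Open Scope ring_scope.

Definition poly_binomial (z : {poly rat}) (n : nat) : {poly rat} :=
  (n`!%:R)^-1 *: \prod_(i < n) (z - i%:R).

(* The index set is infinite: the sum of fsbigop is that of the nonzero terms,
   which are finitely many here (and 0 by convention otherwise). *)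
Definition baxter_poly (r : nat) : {poly rat} :=
  \sum_(lq \in [set lq : nat * nat | (1 <= lq.1)%N /\ (1 <= lq.2)%N]%classic)
    (path_count r lq.1 lq.2)%:R *
    poly_binomial ('X - lq.1%:R + lq.2%:R - 1) lq.2.-1.

(* Main.v *)
Require Import Defs.
From mathcomp Require Import classical_sets fsbigop.
From mathcomp Require Import all_boot all_order all_algebra.
From mathcomp Require Import zify ring.

Set Implicit Arguments.
Unset Strict Implicit.
Unset Printing Implicit Defensive.

Import GRing.Theory Num.Theory.

(** Reading a matrix column by column, the automaton tracks exactly which rows
    have been met by a 1 and which rows an unsatisfied pinwheel has closed
    ([prefix_state], [accepted_from_prefix]).  Three segments of a pinwheel at
    columns y and y + 1 are decided once column y + 1 is read; if all three
    contain a 1, the fourth demands that one row be empty from then on.  Hence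
    Baxter matrices are the accepted words ([baxter_count_words]).

    Rank the rowstates by 2 < 1 = 4 < 3 and a state by the sum of the ranks of
    its rows.  The essential fact ([step_rank_lt]) is that every transition
    which is not a self-loop raises the rank.  Indeed, if it does not, then no
    row is met for the first time and no row is closed for the first time; but
    between a row of the new column and a different row of the old one the
    pinwheels would then close one row after another, up to a row holding a 1
    ([stagnant_columns]).  So both columns are the same single row, and the
    state does not change.

    A non-start state has a row in rowstate 1, so its rank lies between 1 and
    2r - 1.  Consequently a path without self-loops has length l at most
    2r - 1, and its states are distinct.  If it has length 2r - 1, its first
    non-start state has rank 1, that is, a column with a single 1, and then
    carries a self-loop ([singleton_self_loop]).  Thus q >= 1 as soon as
    l = 2r - 1.

    An accepted word of length k is a path without self-loops into which k - l
    self-loops are inserted at its q self-loop states.  This gives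
    'C(k - l + q - 1, k - l) words for each path ([word_count_paths]).  For
    k >= 2r - 1 every path has l <= k, the paths with q = 0 contribute nothing,
    and the binomial coefficients agree with the polynomials
    ([word_count_box], [horner_path_term]).

    The term of (l, q) has degree q - 1 <= l - 1 <= 2r - 2 with a nonnegative
    leading coefficient.  The degree 2r - 2 is attained because the 1 may walk
    from the first row to the last and back, through 2r - 1 states that all
    carry self-loops ([path_count_longest_gt0]). *)

(** * The rank of a state *)

Lemma forcedP r (s : {ffun 'I_r -> rowstate}) (c' : {set 'I_r}) i :
  reflect [\/ s i = RS3,
    exists x j j' : 'I_r, [/\ i = x.+1 :> nat, j \in c', j <= x, s x <> RS2
      & s j' = RS1 /\ i <= j']
  | exists y j j' : 'I_r, [/\ y = i.+1 :> nat, s j = RS1, j <= i, s y <> RS2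
      & j' \in c' /\ y <= j']] (i \in forced s c').
Proof.
rewrite /forced inE; apply: (iffP or3P).
- case=> [/eqP ->|/existsP[x /and4P[/eqP ix /existsP[j /andP[jc jx]] /eqP sx]]|
    /existsP[y /and4P[/eqP iy /existsP[j /andP[jc jx]] /eqP sy]]].
  + exact: Or31.
  + case/existsP=> j' /andP[]; rewrite inE => /eqP sj' ij'.
    by apply: Or32; exists x, j, j'.
  + move: jc; rewrite inE => /eqP sj /existsP[j' /andP[j'c yj']].
    by apply: Or33; exists y, j, j'.
- case=> [->|[x [j [j' [ix jc jx /eqP sx [sj' ij']]]]]|
    [y [j [j' [iy sj jx /eqP sy [jc ij']]]]]].
  + exact: Or31.
  + apply: Or32; apply/existsP; exists x; rewrite ix eqxx sx.
    apply/and3P; split=> //; apply/existsP; [exists j|exists j'].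
      by rewrite jc jx.
    by rewrite inE sj' eqxx -ix.
  + apply: Or33; apply/existsP; exists y; rewrite iy eqxx sy.
    apply/and3P; split=> //; apply/existsP; [exists j|exists j'].
      by rewrite inE sj eqxx jx.
    by rewrite jc -iy.
Qed.

Lemma rejectedPn r (s : {ffun 'I_r -> rowstate}) (c' : {set 'I_r}) :
  reflect (forall i, i \in forced s c' -> i \notin c' /\ s i <> RS2)
          (~~ rejected s c').
Proof.
rewrite /rejected negb_or negbK; apply: (iffP andP).
- case=> /eqP F0 /existsPn sF i iF; split.
    by apply/negP => ic; move/setP/(_ i): F0; rewrite in_setI iF ic in_set0.
  by apply/eqP; move: (sF i); rewrite iF.
- move=> h; split.
    apply/eqP/setP => i; rewrite in_setI in_set0; apply/negP => /andP[/h[]].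
    by move=> /negP.
  by apply/existsPn => i; apply/negP => /andP[/h[_ /eqP /negPf ->]].
Qed.

(** The order in which a row can pass through the rowstates: only 1 and 4 may
    alternate. *)
Definition rowstate_rank (t : rowstate) : nat :=
  match t with RS2 => 0 | RS1 | RS4 => 1 | RS3 => 2 end.

Definition state_rank r (s : state r) : nat :=
  if s is Some t then \sum_i rowstate_rank (val t i) else 0.

(** One row has rowstate 1, hence rank 1 instead of 2. *)
Lemma state_rank_le r (s : state r) : state_rank s <= 2 * r - 1.
Proof.
case: s => [[s hs]|//] /=; case/existsP: (hs) => i0 /eqP si0.
rewrite (bigD1 i0) //= si0 /=.
have: \sum_(i < r | i != i0) rowstate_rank (s i) <= \sum_(i < r | i != i0) 2.
  by apply: leq_sum => i _; case: (s i).
rewrite sum_nat_const cardC1 card_ord; have := ltn_ord i0.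
by move: (\sum_(_ < r | _) _) => n; lia.
Qed.

(** Suppose that a row j of the new column lies above a row i of the old one.
    Row j was met before, so a clockwise pinwheel closes the row below it.  This
    row was closed, hence met, already, so the next row is closed as well, and
    so on down to row i; but row i holds a 1.  The counterclockwise pinwheels
    do the same upwards when j lies below i. *)
Lemma stagnant_columns r (s : {ffun 'I_r -> rowstate}) (c' : {set 'I_r}) :
  {in c', forall i, s i <> RS2} -> {in forced s c', forall i, s i = RS3} ->
  forall i j, s i = RS1 -> j \in c' -> i = j.
Proof.
move=> sc sF i j si jc.
(* From j downwards to i, as rows are numbered from the top. *)
have below_j n (x : 'I_r) : x = j + n.+1 :> nat -> x <= i -> s x = RS3.
  elim: n x => [|n IHn] x xj xi; apply: sF; apply/forcedP; apply: Or32.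
    exists j, j, i; split=> //; first by lia.
    exact: sc.
  have hx : j + n.+1 < r by have := ltn_ord x; lia.
  exists (Ordinal hx), j, i; split=> //=; try lia; try by split; lia.
  by rewrite IHn //=; lia.
(* From j upwards to i. *)
have above_j n (x : 'I_r) : j = x + n.+1 :> nat -> i <= x -> s x = RS3.
  elim: n x => [|n IHn] x xj xi; apply: sF; apply/forcedP; apply: Or33.
    exists j, i, j; split=> //; first by lia.
    exact: sc.
  have hx : x.+1 < r by have := ltn_ord j; lia.
  exists (Ordinal hx), i, j; split=> //=; try by split; lia.
  by rewrite IHn //=; lia.
apply/val_inj => /=; case: (ltngtP i j) => // h.
  by move: si; rewrite (above_j (j - i.+1)) //; lia.
by move: si; rewrite (below_j (i - j.+1)) //; lia.
Qed.

(** No row ever loses rank.  If the sum is unchanged, then every row keeps its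
    rank, so rows of the new column were already met and closed rows were
    already closed: [stagnant_columns] applies to all pairs of rows. *)
Lemma step_rank_lt r (s t : nonstart r) (c' : symbol r) :
  transition (Some s) c' = Some (Some t) -> t != s ->
  state_rank (Some s) < state_rank (Some t).
Proof.
rewrite /=; case: ifPn => // /rejectedPn rej [<-] ts.
have rk_le i : rowstate_rank (val s i) <=
    rowstate_rank (step_target (val s) (val c') i).
  rewrite ffunE; case: ifP => [ic|_].
    case si: (val s i) => //; case: (rej i); last by rewrite ic.
    by apply/forcedP; apply: Or31.
  case: ifP => [_|iF]; first by case: (val s i).
  case: eqP => [->//|_]; case si: (val s i) => //.
  by move/negP: iF; case; apply/forcedP; apply: Or31.
rewrite ltn_neqAle leq_sum // andbT; apply: contraNneq ts => /= eq_rk.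
have rk_eq i : rowstate_rank (val s i) =
    rowstate_rank (step_target (val s) (val c') i).
  apply/eqP; have := @leqif_sum _ predT _ _ _
    (fun i _ => leqif_eq (rk_le i)).
  by case=> _; rewrite eq_rk eqxx => /esym /forall_inP /(_ i isT).
have sF i : i \in forced (val s) (val c') -> val s i = RS3.
  move=> iF; have := rk_eq i; rewrite ffunE iF.
  by case: (rej _ iF) => /negPf -> _; case: (val s i).
have sc i : i \in val c' -> val s i <> RS2.
  by move=> ic; have := rk_eq i; rewrite ffunE ic; case: (val s i).
have eqc := stagnant_columns sc sF.
have [i0 /eqP si0] := existsP (valP s).
have [j0 jc0] := set0Pn _ (valP c').
apply/eqP/val_inj/ffunP => i; rewrite SubK ffunE.
case: ifPn => [/(eqc _ _ si0) <- //|ic].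
case: ifPn => [/sF //|iF]; case: eqP => // si2.
case si: (val s i) si2 => // _; last first.
  by case/negP: iF; apply/forcedP; apply: Or31.
by move: ic; rewrite (eqc _ _ si jc0) jc0.
Qed.

Lemma transition_rank_lt r (s t : state r) (c : symbol r) :
  transition s c = Some t -> s != t -> state_rank s < state_rank t.
Proof.
case: s => [s|]; last first.
  move=> [<-] _ /=; have [i ic] := set0Pn _ (valP c).
  by rewrite (bigD1 i) //= ffunE ic.
case: t => [t|] st nst; last by move: st => /=; case: ifP.
by apply: step_rank_lt st _; apply: contraNneq nst => ->.
Qed.

(** A pinwheel between two equal columns closes a row only if the column has
    two different rows. *)
Lemma singleton_self_loop r (s : nonstart r) :
  (forall i j, val s i = RS1 -> val s j = RS1 -> i = j) ->
  has_self_loop (Some s).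
Proof.
move=> s1; have s0 : column (val s) != set0.
  by have [i si] := existsP (valP s); apply/set0Pn; exists i; rewrite inE.
have F3 i : i \in forced (val s) (column (val s)) -> val s i = RS3.
  case/forcedP=> // [[x [j [j' []]]]|[x [j [j' []]]]] ix.
    rewrite inE => /eqP sj jx _ [sj' ij'].
    by move: ix ij'; rewrite -(s1 _ _ sj sj'); lia.
  move=> sj ji _ []; rewrite inE => /eqP sj' xj'.
  by move: ix xj'; rewrite -(s1 _ _ sj sj'); lia.
apply/existsP; exists (Sub (column (val s)) s0); rewrite /transition.
rewrite ifN; last first.
  by apply/rejectedPn => i; rewrite SubK => /F3 si; rewrite inE si.
apply/eqP; congr (Some (Some _)); apply/val_inj/ffunP => i.
rewrite !SubK ffunE [i \in column _]inE.
case: eqP => [-> //|si1]; case: ifPn => [/F3 -> //|iF].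
case: eqP => [-> //|si2]; case si: (val s i) si1 si2 => // _ _.
by case/negP: iF; apply/forcedP; apply: Or31.
Qed.

(** * Paths without self-loops *)

Definition targets r (p : seq (symbol r * state r)) : seq (state r) :=
  [seq e.2 | e <- p].

Definition loopfree_path r (s : state r) (p : seq (symbol r * state r)) :=
  automaton_path s p && path (fun s t : state r => s != t) s (targets p).

Definition loopfree_accepting r (s : state r) (p : seq (symbol r * state r)) :=
  loopfree_path s p && accept (last s (targets p)).

Lemma loopfree_path_cons r (s : state r) e (p : seq (symbol r * state r)) :
  loopfree_path s (e :: p) =
    [&& transition s e.1 == Some e.2, s != e.2 & loopfree_path e.2 p].
Proof.
case: e => c t; rewrite /loopfree_path /=; case: (_ == _) => //=.
by case: (s != t); rewrite //= andbF.
Qed.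

Lemma loopfree_path_ranks r (s : state r) (p : seq (symbol r * state r)) :
  loopfree_path s p ->
  path ltn (state_rank s) [seq state_rank t | t <- targets p].
Proof.
elim: p s => //= -[c t] p IHp s; rewrite loopfree_path_cons /=.
by case/and3P=> /eqP st nst /IHp ->; rewrite (transition_rank_lt st).
Qed.

Lemma loopfree_path_uniq r (s : state r) (p : seq (symbol r * state r)) :
  loopfree_path s p -> uniq (s :: targets p).
Proof.
move=> /loopfree_path_ranks rk; apply: (@map_uniq _ _ (@state_rank r)).
exact: (sorted_uniq ltn_trans ltnn).
Qed.

Lemma loopfree_path_size r (s : state r) (p : seq (symbol r * state r)) :
  loopfree_path s p -> state_rank s + size p <= 2 * r - 1.
Proof.
elim: p s => [|[c t] p IHp] s; first by rewrite addn0 state_rank_le.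
rewrite loopfree_path_cons /= => /and3P[/eqP st nst /IHp].
by have := transition_rank_lt st nst; lia.
Qed.

Definition self_loop_count r (s : state r) (p : seq (symbol r * state r)) :=
  count (@has_self_loop r) (s :: targets p).

Lemma start_no_self_loop r : has_self_loop (None : state r) = false.
Proof. exact/negbTE/existsPn. Qed.

(** The definition counts distinct states; along a path without self-loops no
    state occurs twice, so self-loop states may be counted by position. *)
Lemma path_countE r l q :
  path_count r l q = #|[set p : l.-tuple (symbol r * state r) |
    loopfree_accepting None p && (self_loop_count None p == q)]|.
Proof.
apply: eq_card => p; rewrite !inE /loopfree_accepting /loopfree_path.
rewrite /no_self_loop_used /= -!andbA.
case: (boolP (automaton_path _ _)) => //= hp.
case: (boolP (path _ _ _)) => //= hn; congr (_ && (_ == q)).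
have uniqp : uniq (states_from_start p).
  by apply: loopfree_path_uniq; rewrite /loopfree_path hp hn.
rewrite /self_loop_count -size_filter -/(states_from_start p).
rewrite -(card_uniqP (filter_uniq _ uniqp)); apply: eq_card => s.
by rewrite !inE mem_filter andbC.
Qed.

Lemma path_count_neq0 r l q : path_count r l q != 0 -> q <= l <= 2 * r - 1.
Proof.
rewrite path_countE cards_eq0 => /set0Pn[p].
rewrite inE => /andP[/andP[/loopfree_path_size /=]].
rewrite add0n size_tuple => -> _ /eqP <-; rewrite andbT /self_loop_count /=.
rewrite start_no_self_loop add0n.
by rewrite (leq_trans (count_size _ _)) // size_map size_tuple.
Qed.

(** The rank of this first state is the number of 1s in the first column. *)
Lemma start_rank_gt1 r (t : state r) (c : symbol r) :
  transition None c = Some t -> ~~ has_self_loop t -> 1 < state_rank t.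
Proof.
move=> [<-]; apply: contraR; rewrite -leqNgt /= => rk.
have c_le1 : #|val c| <= 1.
  apply: leq_trans rk; rewrite -sum1_card big_mkcond leq_sum // => i _.
  by rewrite ffunE; case: (i \in _).
apply: singleton_self_loop => i j; rewrite !ffunE.
by case: ifP => // ic _; case: ifP => // jc _; apply: (card_le1_eqP c_le1).
Qed.

(** Such a path gains at least 2r - 2 in rank from its first non-start state on,
    so that state has rank 1 and carries a self-loop. *)
Lemma longest_path_self_loop r : 0 < r -> path_count r (2 * r - 1) 0 = 0.
Proof.
move=> r_gt0; apply/eqP; rewrite path_countE cards_eq0; apply/set0Pn => -[p].
rewrite inE => /andP[/andP[hp _]] /eqP q0.
case: p hp q0 => -[|[c t] p] /= /eqP size_p; first by lia.
rewrite loopfree_path_cons /self_loop_count /= => /and3P[/eqP st _ hp].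
move=> /eqP; rewrite !addn_eq0 => /and3P[_ /[!eqb0] t_noloop _].
have := loopfree_path_size hp.
by rewrite -size_p -add1n leq_add2r leqNgt (start_rank_gt1 st t_noloop).
Qed.

(** * A longest path *)

(** The state after a single 1 has walked downwards to row m (with RS2: the
    rows below are still empty), or has walked to the last row and back to row
    m (with RS3: the rows below are closed). *)
Definition zigzag_state r (below : rowstate) (m : nat) :
    {ffun 'I_r -> rowstate} :=
  [ffun i : 'I_r =>
    if i < m then RS4 else if i == m :> nat then RS1 else below].

Lemma zigzag_nonstart r below (m : 'I_r) :
  [exists i, zigzag_state r below m i == RS1].
Proof. by apply/existsP; exists m; rewrite ffunE ltnn eqxx. Qed.

Definition zigzag r below (m : 'I_r) : nonstart r :=
  Sub (zigzag_state r below m) (zigzag_nonstart below m).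

Definition singleton r (m : 'I_r) : symbol r :=
  Sub [set m] (introT (set0Pn _) (ex_intro _ m (set11 m))).

Lemma zigzag_self_loop r below (m : 'I_r) :
  below != RS1 -> has_self_loop (Some (zigzag below m)).
Proof.
move=> nRS1; apply: singleton_self_loop => i j; rewrite !ffunE.
case: ltngtP => // [_ h|im _]; first by rewrite h in nRS1.
case: ltngtP => // [_ h|jm _]; first by rewrite h in nRS1.
by apply/val_inj; rewrite /= im jm.
Qed.

Lemma zigzag_go r (m m' : 'I_r) : m' = m.+1 :> nat ->
  transition (Some (zigzag RS2 m)) (singleton m') = Some (Some (zigzag RS2 m')).
Proof.
move=> mm'; have F0 i : i \notin forced (zigzag_state r RS2 m) [set m'].
  apply/negP => /forcedP; rewrite ffunE => -[|[x [j [j' []]]]|[y [j [j' []]]]].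
  - by case: ltngtP.
  - rewrite !ffunE inE => ix /eqP -> jx _ [sj' ij'].
    by move: sj'; case: ltngtP => //; lia.
  - rewrite !ffunE inE => yi; case: ltngtP => // jm _ ji sy [/eqP j'm' yj'].
    by move: sy; case: ltngtP => //; move: yj'; rewrite j'm'; lia.
rewrite /transition ifN; last first.
  by apply/rejectedPn => i; rewrite !SubK (negPf (F0 i)).
congr (Some (Some _)); apply/val_inj/ffunP => i.
rewrite !SubK !ffunE (negPf (F0 i)) inE -val_eqE /= mm'.
by case: (ltngtP i m.+1); case: (ltngtP i m) => //; lia.
Qed.

Lemma zigzag_back r (m m' : 'I_r) : m = m'.+1 :> nat ->
  transition (Some (zigzag RS3 m)) (singleton m') = Some (Some (zigzag RS3 m')).
Proof.
move=> mm'; have FE i : i \in forced (zigzag_state r RS3 m) [set m'] = (m' < i).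
  apply/idP/idP => [/forcedP|lt_m'i].
    rewrite ffunE => -[|[x [j [j' []]]]|[y [j [j' []]]]].
    - by case: ltngtP => //; lia.
    - by rewrite !ffunE inE => ix /eqP ->; lia.
    - rewrite !ffunE inE => yi; case: ltngtP => // jm _ ji sy [/eqP -> yj'].
      by lia.
  apply/forcedP; case: (ltngtP m i) => mi.
  - by apply: Or31; rewrite ffunE; case: ltngtP mi.
  - by lia.
  - have sm : zigzag_state r RS3 m m = RS1 by rewrite ffunE ltnn eqxx.
    have sm' : zigzag_state r RS3 m m' = RS4 by rewrite ffunE mm' ltnSn.
    apply: Or32; exists m', m', m; rewrite set11 sm sm' -mi -mm'.
    by split.
rewrite /transition ifN; last first.
  apply/rejectedPn => i; rewrite !SubK FE inE -val_eqE /= ffunE => lt_m'i.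
  by split; [case: ltngtP lt_m'i|case: ltngtP].
congr (Some (Some _)); apply/val_inj/ffunP => i.
rewrite !SubK !ffunE FE inE -val_eqE /= mm'.
by case: (ltngtP i m'.+1); case: (ltngtP i m') => //; lia.
Qed.

(** From row m the 1 walks back to row 0. *)
Lemma zigzag_return_path r n (m : 'I_r) : m = n :> nat -> exists p,
  [/\ size p = n, loopfree_accepting (Some (zigzag RS3 m)) p &
    self_loop_count (Some (zigzag RS3 m)) p = n.+1].
Proof.
elim: n m => [|n IHn] m mn.
  exists [::]; rewrite /self_loop_count /loopfree_accepting /=.
  rewrite zigzag_self_loop //; split=> //.
  by apply/forallP => i; rewrite ffunE; case: ltngtP.
have hn : n < r by have := ltn_ord m; lia.
have [p [size_p hp qp]] := IHn (Ordinal hn) erefl.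
exists ((singleton (Ordinal hn), Some (zigzag RS3 (Ordinal hn))) :: p).
have /andP[lp ap] := hp.
rewrite /self_loop_count /loopfree_accepting loopfree_path_cons.
rewrite [transition _ _]zigzag_back // eqxx lp ap /= size_p.
move: qp; rewrite /self_loop_count /= !zigzag_self_loop // => ->; split=> //.
rewrite !andbT; apply/eqP => -[] /ffunP /(_ m); rewrite !ffunE ltnn eqxx /= mn.
by case: ltngtP => //; lia.
Qed.

(** From row m the 1 walks n rows down to the last row, then r - 1 rows up. *)
Lemma zigzag_round_trip r n (m : 'I_r) : m + n.+1 = r -> exists p,
  [/\ size p = n + r.-1, loopfree_accepting (Some (zigzag RS2 m)) p &
    self_loop_count (Some (zigzag RS2 m)) p = (n + r.-1).+1].
Proof.
elim: n m => [|n IHn] m mn.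
  (* At the last row no row is below. *)
  have -> : zigzag RS2 m = zigzag RS3 m.
    apply/val_inj/ffunP => i; rewrite !ffunE.
    by case: ltngtP => //; have := ltn_ord i; lia.
  by apply: zigzag_return_path; lia.
have hm : m.+1 < r by lia.
have [|p [size_p hp qp]] := IHn (Ordinal hm); first by rewrite /=; lia.
exists ((singleton (Ordinal hm), Some (zigzag RS2 (Ordinal hm))) :: p).
have /andP[lp ap] := hp.
rewrite /self_loop_count /loopfree_accepting loopfree_path_cons.
rewrite [transition _ _]zigzag_go // eqxx lp ap /= size_p.
move: qp; rewrite /self_loop_count /= !zigzag_self_loop // => ->; split=> //.
rewrite !andbT; apply/eqP => -[] /ffunP /(_ m); rewrite !ffunE ltnn eqxx /=.
by case: ltngtP => //; lia.
Qed.

Lemma path_count_longest_gt0 r : 0 < r ->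
  0 < path_count r (2 * r - 1) (2 * r - 1).
Proof.
move=> r_gt0.
have [|p [size_p hp qp]] := @zigzag_round_trip r r.-1 (Ordinal r_gt0).
  by rewrite /= prednK.
rewrite path_countE card_gt0; apply/set0Pn.
have size_p' : size ((singleton (Ordinal r_gt0),
    Some (zigzag RS2 (Ordinal r_gt0))) :: p) == 2 * r - 1.
  by rewrite /= size_p; lia.
exists (Tuple size_p'); rewrite inE /=.
have /andP[lp ap] := hp.
rewrite /self_loop_count /loopfree_accepting loopfree_path_cons lp ap /=.
move: qp; rewrite /self_loop_count /= => ->.
rewrite start_no_self_loop add0n.
rewrite [_ == 2 * r - 1](_ : _ = true) ?andbT; last by lia.
apply/eqP; congr (Some (Some _)); apply/val_inj/ffunP => i.
by rewrite !ffunE inE.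
Qed.

(** * Words as paths with inserted self-loops *)

Lemma big_tuple_cons (T : finType) n (F : n.+1.-tuple T -> nat) :
  \sum_p F p = \sum_x \sum_(p : n.-tuple T) F (cons_tuple x p).
Proof.
rewrite pair_big /= (reindex (fun xp : T * n.-tuple T => cons_tuple xp.1 xp.2)).
  by apply: eq_bigr => -[].
exists (fun p : n.+1.-tuple T => (thead p, behead_tuple p)) => [[x p] _|p _].
  by congr (_, _) => /=; apply/val_inj.
by rewrite [RHS]tuple_eta.
Qed.

Fixpoint accepted r (s : state r) (w : seq (symbol r)) : bool :=
  if w is c :: w' then
    if transition s c is Some t then accepted t w' else false
  else accept s.

Definition word_count r (s : state r) k :=
  #|[set w : k.-tuple (symbol r) | accepted s w]|.

Definition sum_targets r (s : state r) (F : state r -> nat) :=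
  \sum_(c : symbol r) (if transition s c is Some t then F t else 0).

Definition sum_other_targets r (s : state r) (F : state r -> nat) :=
  sum_targets s (fun t => if s != t then F t else 0).

Lemma card_sum_bool (T : finType) (P : pred T) :
  #|[set x | P x]| = \sum_x (P x : nat).
Proof. by rewrite cardsE -sum1_card big_mkcond. Qed.

Lemma word_countS r (s : state r) k :
  word_count s k.+1 = sum_targets s (fun t => word_count t k).
Proof.
rewrite /word_count card_sum_bool big_tuple_cons; apply: eq_bigr => c _ /=.
case: (transition s c) => [t|]; first by rewrite card_sum_bool.
by rewrite big1.
Qed.

(** The target of a transition shows the column that was read. *)
Lemma self_loop_symbol_uniq r (s : state r) (c d : symbol r) :
  transition s c = Some s -> transition s d = Some s -> c = d.
Proof.
case: s => [s|] //=; case: ifP => // _ [sc]; case: ifP => // _ [sd].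
apply/val_inj/setP => i; move: sc sd => /(congr1 val)/ffunP/(_ i) sc.
move=> /(congr1 val)/ffunP/(_ i); rewrite -sc !SubK !ffunE.
by case: (i \in val d); case: (i \in val c) => //; do ?case: ifP.
Qed.

Lemma sum_targets_self_loop r (s : state r) (F : state r -> nat) :
  sum_targets s F =
    (if has_self_loop s then F s else 0) + sum_other_targets s F.
Proof.
rewrite /sum_other_targets /sum_targets.
case: (boolP (has_self_loop s)) => [/existsP[c /eqP sc]|/existsPn no_loop].
  rewrite (bigD1 c) //= [in RHS](bigD1 c) //= sc eqxx add0n; congr (_ + _).
  apply: eq_bigr => d dc; case sd: (transition s d) => [t|] //.
  case: eqP => // st; case/eqP: dc; apply: self_loop_symbol_uniq sc.
  by rewrite sd st.
apply: eq_bigr => c _; case sc: (transition s c) => [t|] //.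
by case: eqP => // st; move: (no_loop c); rewrite sc st eqxx.
Qed.

Definition path_sum r (s : state r) l (g : nat -> nat) :=
  \sum_(p : l.-tuple (symbol r * state r) | loopfree_accepting s p)
    g (self_loop_count s p).

Lemma path_sum0 r (s : state r) g :
  path_sum s 0 g = if accept s then g (has_self_loop s) else 0.
Proof.
rewrite /path_sum big_mkcond (eq_bigr (fun _ =>
  if accept s then g (has_self_loop s) else 0)).
  by rewrite sum_nat_const card_tuple expn0 mul1n.
by move=> p _; rewrite tuple0 /self_loop_count /= addn0.
Qed.

Lemma path_sumS r (s : state r) l g : path_sum s l.+1 g =
  sum_other_targets s
    (fun t => path_sum t l (fun q => g (has_self_loop s + q))).
Proof.
rewrite /path_sum big_mkcond big_tuple_cons.
transitivity (\sum_c \sum_t \sum_(p : l.-tuple (symbol r * state r))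
    if loopfree_accepting s ((c, t) :: p)
    then g (self_loop_count s ((c, t) :: p))
    else 0).
  by rewrite [RHS]pair_bigA; apply: eq_bigr => -[].
apply: eq_bigr => c _.
have no_path t : transition s c != Some t ->
    forall p, loopfree_accepting s ((c, t) :: p) = false.
  by move=> st p; rewrite /loopfree_accepting loopfree_path_cons (negPf st).
case st: (transition s c) => [t|]; last first.
  by rewrite big1 // => t _; rewrite big1 // => p _; rewrite no_path ?st.
rewrite (bigD1 t) //= [X in _ + X]big1 ?addn0 => [|t' nt]; last first.
  rewrite big1 // => p _; rewrite no_path // st.
  by apply: contraNneq nt => -[->].
rewrite [in RHS]big_mkcond /=; case: ifP => [nst|nst]; last first.
  rewrite big1 // => p _.
  by rewrite /loopfree_accepting loopfree_path_cons nst andbF.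
apply: eq_bigr => p _; rewrite /loopfree_accepting loopfree_path_cons nst.
by rewrite [transition _ _]st eqxx.
Qed.

(** The number of ways to distribute n self-loops over q self-loop states.
    The truncated predecessor makes it [n == 0] for q = 0. *)
Definition loop_placements n q := 'C((n + q).-1, n).

(** Either the first of the q + 1 states takes one of the n + 1 loops, or it
    takes none. *)
Lemma loop_placementsS n q : loop_placements n.+1 q.+1 =
  loop_placements n q.+1 + loop_placements n.+1 q.
Proof.
by rewrite /loop_placements addnS addSn /= binS addnS /= addnC.
Qed.

(** Paths without self-loops, each weighted with the number of ways to bring it
    to length k by inserting self-loops. *)
Definition looped_path_count r (s : state r) k :=
  \sum_(l < k.+1) path_sum s l (loop_placements (k - l)).

Lemma sum_targetsD r (s : state r) F G :
  sum_other_targets s (fun t => F t + G t) =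
  sum_other_targets s F + sum_other_targets s G.
Proof.
rewrite -big_split; apply: eq_bigr => c _.
by case: transition => // t; case: ifP.
Qed.

Lemma sum_targets_sum r (s : state r) n (F : 'I_n -> state r -> nat) :
  sum_other_targets s (fun t => \sum_l F l t) =
  \sum_l sum_other_targets s (F l).
Proof.
rewrite exchange_big; apply: eq_bigr => c _.
case: transition => [t|]; last by rewrite big1.
by case: ifP => // _; rewrite big1.
Qed.

Lemma eq_sum_targets r (s : state r) F G : F =1 G ->
  sum_other_targets s F = sum_other_targets s G.
Proof.
by move=> eFG; apply: eq_bigr => c _; case: transition => // t; rewrite eFG.
Qed.

Lemma eq_path_sum r (s : state r) l g h :
  g =1 h -> path_sum s l g = path_sum s l h.
Proof. by move=> egh; apply: eq_bigr => p _; rewrite egh. Qed.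

(** The first transition of a path with inserted self-loops is a self-loop at
    s, or leads to another state; for s without self-loop only the latter is
    possible. *)
Lemma looped_path_countS r (s : state r) k : looped_path_count s k.+1 =
  (if has_self_loop s then looped_path_count s k else 0) +
  sum_other_targets s (fun t => looped_path_count t k).
Proof.
rewrite {1}/looped_path_count big_ord_recl path_sum0 subn0.
under eq_bigr => l _ do rewrite path_sumS /= /bump /= add1n subSS.
rewrite /looped_path_count sum_targets_sum.
case loop_s: (has_self_loop s); last first.
  by rewrite {1}/loop_placements addn0 /= bin_small // if_same.
rewrite [in RHS]big_ord_recl path_sum0 loop_s subn0 -addnA.
congr (_ + _).
  by rewrite /loop_placements !addn1 /= !binn.
(* Either a self-loop at s comes first, or none is inserted there; the former
   needs k - l > 0. *)
have split_loop l : l < k.+1 ->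
    sum_other_targets s
      (fun t => path_sum t l (fun q => loop_placements (k - l) (1 + q)))
  = (if l < k then path_sum s l.+1 (loop_placements (k - l.+1)) else 0) +
    sum_other_targets s (fun t => path_sum t l (loop_placements (k - l))).
  rewrite ltnS leq_eqVlt => /orP[/eqP -> |lt_lk].
    rewrite ltnn subnn; apply: eq_sum_targets => t; apply: eq_path_sum => q.
    by rewrite /loop_placements !bin0.
  rewrite lt_lk path_sumS loop_s -sum_targetsD; apply: eq_sum_targets => t.
  rewrite -big_split; apply: eq_bigr => p _ /=.
  have -> : k - l = (k - l.+1).+1 by lia.
  exact: loop_placementsS.
under eq_bigr => l _ do rewrite (split_loop l (ltn_ord l)).
rewrite big_split /= big_ord_recr /= ltnn addn0; congr (_ + _).
by apply: eq_bigr => l _; rewrite ltn_ord.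
Qed.

(** Both sides satisfy the same recursion on the first transition. *)
Lemma word_count_paths r (s : state r) k :
  word_count s k = looped_path_count s k.
Proof.
elim: k s => [|k IHk] s.
  rewrite /looped_path_count big_ord1 path_sum0 /loop_placements bin0.
  rewrite /word_count card_sum_bool (eq_bigr (fun _ => accept s : nat)).
    by rewrite sum_nat_const card_tuple expn0 mul1n; case: accept.
  by move=> w _; rewrite tuple0.
rewrite word_countS looped_path_countS sum_targets_self_loop IHk; congr (_ + _).
exact: eq_sum_targets.
Qed.

Lemma path_sum_by_count r l g : 0 < r ->
  path_sum (None : state r) l g = \sum_(0 <= q < 2 * r) path_count r l q * g q.
Proof.
move=> r_gt0; have q_small (p : l.-tuple (symbol r * state r)) :
    loopfree_accepting None p -> self_loop_count None p < 2 * r.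
  move=> hp; have : path_count r l (self_loop_count None p) != 0.
    by rewrite path_countE cards_eq0; apply/set0Pn; exists p; rewrite inE hp /=.
  by move/path_count_neq0; lia.
transitivity (
    \sum_(p : l.-tuple (symbol r * state r) | loopfree_accepting None p)
    \sum_(q < 2 * r) (self_loop_count None p == q) * g q).
  apply: eq_bigr => p /q_small hq; rewrite (bigD1 (Ordinal hq)) //= eqxx mul1n.
  rewrite big1 ?addn0 // => q; rewrite -val_eqE /= eq_sym => /negPf -> //.
rewrite exchange_big big_mkord; apply: eq_bigr => q _ /=.
rewrite -big_distrl path_countE card_sum_bool big_mkcond; congr (_ * _).
by apply: eq_bigr => p _; case: loopfree_accepting.
Qed.

(** The range of l and q comes from [path_count_neq0].  The terms with q = 0
    vanish: for l < k no self-loop can be inserted, and l = k forces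
    l = 2r - 1, where [longest_path_self_loop] applies. *)
Lemma word_count_box r k : 0 < r -> 2 * r - 1 <= k ->
  word_count (None : state r) k =
  \sum_(1 <= l < 2 * r) \sum_(1 <= q < 2 * r)
    path_count r l q * 'C(k - l + q - 1, q - 1).
Proof.
move=> r_gt0 hk; rewrite word_count_paths /looped_path_count.
rewrite -(big_mkord xpredT
  (fun l => path_sum None l (loop_placements (k - l)))).
have count0 l q : (q <= l <= 2 * r - 1) = false -> path_count r l q = 0.
  by apply: contraFeq; apply: path_count_neq0.
rewrite (@big_cat_nat _ _ _ (2 * r)) //=; last by lia.
rewrite [X in _ + X]big_nat_cond [X in _ + X]big1 ?addn0; last first.
  move=> l /andP[/andP[hl _] _]; rewrite path_sum_by_count // big1 // => q _.
  by rewrite count0 //; lia.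
rewrite big_ltn; last by lia.
have -> : path_sum (None : state r) 0 (loop_placements (k - 0)) = 0.
  by rewrite path_sum0.
rewrite add0n [LHS]big_nat_cond [RHS]big_nat_cond; apply: eq_bigr.
move=> l /andP[/andP[l_gt0 lt_l] _]; rewrite path_sum_by_count //.
rewrite big_ltn; last by lia.
have -> : path_count r l 0 * loop_placements (k - l) 0 = 0.
  have [lt_lk|le_kl] := ltnP l k.
    by rewrite /loop_placements addn0 bin_small ?muln0 //; lia.
  have -> : l = 2 * r - 1 by lia.
  by rewrite longest_path_self_loop.
rewrite add0n [LHS]big_nat_cond [RHS]big_nat_cond; apply: eq_bigr.
move=> q /andP[/andP[q_gt0 _] _]; congr (_ * _); rewrite /loop_placements.
rewrite -[in LHS](@bin_sub _ (k - l)); last by lia.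
by congr ('C(_, _)); lia.
Qed.

(** * Baxter matrices as accepted words *)

Definition met r (c : nat -> {set 'I_r}) y (i : 'I_r) : bool :=
  [exists j : 'I_y.+1, i \in c j].

(** Segments A, B and D of the pinwheel between columns y and y + 1 all contain
    a 1, so that segment C (or C') must be empty. *)
Definition cw_forces r (c : nat -> {set 'I_r}) y (x x' : 'I_r) : bool :=
  [&& [exists j in c y.+1, j <= x], met c y x & [exists j in c y, x' <= j]].

Definition ccw_forces r (c : nat -> {set 'I_r}) y (x x' : 'I_r) : bool :=
  [&& [exists j in c y, j <= x], met c y x' & [exists j in c y.+1, x' <= j]].

Definition newly_forced r (c : nat -> {set 'I_r}) y (i : 'I_r) : bool :=
  [exists x : 'I_r, (i == x.+1 :> nat) && cw_forces c y x i] ||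
  [exists x' : 'I_r, (x' == i.+1 :> nat) && ccw_forces c y i x'].

(** The bound on y0 is strict because the pinwheel at y0 also involves column
    y0 + 1. *)
Definition closed_row r (c : nat -> {set 'I_r}) y (i : 'I_r) : bool :=
  [exists y0 : 'I_y, newly_forced c y0 i].

(** The conditions on columns 0 to y which the automaton enforces.  It rejects
    as soon as a row is closed before it is met, since such a row would stay
    empty; this is the first conclusion. *)
Definition compatible r (c : nat -> {set 'I_r}) y :=
  forall y0 i, y0 < y -> newly_forced c y0 i ->
    met c y0 i /\ forall j, y0 < j <= y -> i \notin c j.

(** The state of the automaton after columns 0 to y, read off directly from
    these columns. *)
Definition prefix_state r (c : nat -> {set 'I_r}) y : {ffun 'I_r -> rowstate} :=
  [ffun i => if i \in c y then RS1 else if closed_row c y i then RS3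
             else if met c y i then RS4 else RS2].

Lemma metP r (c : nat -> {set 'I_r}) y i :
  reflect (exists2 j, j <= y & i \in c j) (met c y i).
Proof.
apply: (iffP existsP) => [[j ij]|[j jy ij]].
  by exists j; rewrite // -ltnS.
by exists (Ordinal (jy : j < y.+1)).
Qed.

Lemma met_le r (c : nat -> {set 'I_r}) y y' i :
  y <= y' -> met c y i -> met c y' i.
Proof. by move=> yy' /metP[j jy ij]; apply/metP; exists j; first lia. Qed.

Lemma metS r (c : nat -> {set 'I_r}) y i :
  met c y.+1 i = (i \in c y.+1) || met c y i.
Proof.
apply/metP/orP => [[j]|[ic|/metP[j jy ij]]].
- rewrite leq_eqVlt => /orP[/eqP -> ->|jy ij]; first by left.
  by right; apply/metP; exists j.
- by exists y.+1.
- by exists j; first lia.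
Qed.

Lemma closed_rowP r (c : nat -> {set 'I_r}) y i :
  reflect (exists2 y0, y0 < y & newly_forced c y0 i) (closed_row c y i).
Proof.
apply: (iffP existsP) => [[y0 fi]|[y0 lt_y0 fi]]; first by exists y0.
by exists (Ordinal lt_y0).
Qed.

Lemma compatible_le r (c : nat -> {set 'I_r}) y y' :
  y <= y' -> compatible c y' -> compatible c y.
Proof.
move=> yy' hc y0 i y0y /hc[|mi cl]; first lia.
by split=> // j hj; apply: cl; lia.
Qed.

Lemma closed_row_met r (c : nat -> {set 'I_r}) y i :
  compatible c y -> closed_row c y i -> met c y i /\ i \notin c y.
Proof.
move=> hc /closed_rowP[y0 y0y /hc[//|mi cl]]; split.
  by apply: met_le mi; apply: ltnW.
by apply: cl; rewrite y0y leqnn.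
Qed.

Lemma prefix_state_RS1 r (c : nat -> {set 'I_r}) y i :
  (prefix_state c y i == RS1) = (i \in c y).
Proof. by rewrite ffunE; do ?case: ifP. Qed.

(** Rowstate 2 is the failure of [met] also for rows in rowstate 3: compatible
    columns close a row only after it is met. *)
Lemma prefix_state_RS2 r (c : nat -> {set 'I_r}) y i : compatible c y ->
  (prefix_state c y i == RS2) = ~~ met c y i.
Proof.
move=> hc; rewrite ffunE; case: ifP => [ic|_].
  by apply/esym/negbF/metP; exists y.
case: ifP => [/(closed_row_met hc)[-> _] //|_].
by case: ifP.
Qed.

Lemma prefix_state_RS3 r (c : nat -> {set 'I_r}) y i : compatible c y ->
  (prefix_state c y i == RS3) = closed_row c y i.
Proof.
move=> hc; rewrite ffunE; case: ifP => [ic|_]; last by do ?case: ifP.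
by apply/esym/negbTE/negP => /(closed_row_met hc)[_ /negP].
Qed.

Lemma closed_rowS r (c : nat -> {set 'I_r}) y i :
  closed_row c y.+1 i = closed_row c y i || newly_forced c y i.
Proof.
apply/closed_rowP/orP => [[y0]|[/closed_rowP[y0 y0y fi]|fi]].
- rewrite ltnS leq_eqVlt => /orP[/eqP -> ->|y0y fi]; first by right.
  by left; apply/closed_rowP; exists y0.
- by exists y0; first lia.
- by exists y.
Qed.

(** The rowstates carry all the history that the set F depends on. *)
Lemma forced_prefix_state r (c : nat -> {set 'I_r}) y i : compatible c y ->
  (i \in forced (prefix_state c y) (c y.+1)) = closed_row c y.+1 i.
Proof.
move=> hc; have col : column (prefix_state c y) = c y.
  by apply/setP => j; rewrite inE prefix_state_RS1.
rewrite /forced inE prefix_state_RS3 // closed_rowS col; congr (_ || (_ || _)).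
  by apply: eq_existsb => x; rewrite /cw_forces prefix_state_RS2 // negbK.
by apply: eq_existsb => x; rewrite /ccw_forces prefix_state_RS2 // negbK.
Qed.

Lemma compatible_step r (c : nat -> {set 'I_r}) y : compatible c y ->
  compatible c y.+1 <-> ~~ rejected (prefix_state c y) (c y.+1).
Proof.
move=> hc; split=> [hc1|/rejectedPn rej y0 i].
  apply/rejectedPn => i; rewrite forced_prefix_state // => cl.
  split; first by case: (closed_row_met hc1 cl).
  apply/eqP; rewrite prefix_state_RS2 // negbK.
  case/closed_rowP: cl => y0 y0y /hc1[//|mi _].
  by apply: met_le mi.
rewrite ltnS => y0y fi.
have /rej[ic /eqP] : i \in forced (prefix_state c y) (c y.+1).
  by rewrite forced_prefix_state //; apply/closed_rowP; exists y0.
rewrite prefix_state_RS2 // negbK => mi.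
move: y0y; rewrite leq_eqVlt => /orP[/eqP y0y|y0y].
  subst y0; split=> // j hj; have -> : j = y.+1 by lia.
  exact: ic.
have [mi0 cl] := hc _ _ y0y fi; split=> // j /andP[y0j].
rewrite leq_eqVlt => /orP[/eqP -> //|jy].
by apply: cl; rewrite y0j.
Qed.

Lemma step_target_prefix_state r (c : nat -> {set 'I_r}) y : compatible c y ->
  step_target (prefix_state c y) (c y.+1) = prefix_state c y.+1.
Proof.
move=> hc; apply/ffunP => i.
rewrite ffunE forced_prefix_state // prefix_state_RS2 //.
by rewrite [RHS]ffunE metS; case: (i \in c y.+1); case: (met c y i).
Qed.

Definition symbols r (c : nat -> symbol r) : nat -> {set 'I_r} :=
  fun y => val (c y).

Lemma prefix_state_nonstart r (c : nat -> symbol r) y :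
  [exists i, prefix_state (symbols c) y i == RS1].
Proof.
have [i ic] := set0Pn _ (valP (c y)); apply/existsP; exists i.
by rewrite prefix_state_RS1.
Qed.

Definition prefix_nonstart r (c : nat -> symbol r) y : nonstart r :=
  Sub (prefix_state (symbols c) y) (prefix_state_nonstart c y).

(** Invariant of a run: as long as no input is rejected, the state is the
    prefix state, and the columns read so far are compatible. *)
Lemma accepted_from_prefix r (c : nat -> symbol r) w y :
  (forall j, j < size w -> nth (c 0) w j = c (y.+1 + j)) ->
  compatible (symbols c) y ->
  accepted (Some (prefix_nonstart c y)) w <->
  compatible (symbols c) (y + size w) /\
  forall i, met (symbols c) (y + size w) i.
Proof.
elim: w y => [|a w IHw] y wc hc.
  rewrite addn0 /=; split=> [/forallP acc|[_ mt]].
    by split=> // i; have := acc i; rewrite prefix_state_RS2 // negbK.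
  by apply/forallP => i; rewrite prefix_state_RS2 // negbK.
have := wc 0 isT; rewrite addn0 => /= ->; rewrite addnS -addSn.
rewrite -/(symbols c y.+1); have := compatible_step hc.
case: ifPn => rej [hc1 hc2].
  by split=> // -[hcw _]; case/hc1: (compatible_le (leq_addr _ _) hcw).
have -> : Sub (step_target (prefix_state (symbols c) y) (symbols c y.+1))
    (step_target_nonstart (prefix_state (symbols c) y) (c y.+1)) =
    prefix_nonstart c y.+1.
  by apply/val_inj; rewrite !SubK step_target_prefix_state.
apply: IHw; last exact: hc2.
by move=> j jw; have := wc j.+1 jw; rewrite addnS -addSn.
Qed.

Lemma accepted_compatible r (c : nat -> symbol r) w n :
  size w = n.+1 -> (forall j, j < size w -> nth (c 0) w j = c j) ->
  accepted None w <-> compatible (symbols c) n /\ forall i, met (symbols c) n i.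
Proof.
case: w => // a w [<-] wc; have /= -> := wc 0 isT.
have -> : Sub (start_target (val (c 0))) (start_target_nonstart (c 0)) =
    prefix_nonstart c 0.
  apply/val_inj/ffunP => i; rewrite !SubK !ffunE; case: ifP => // ic.
  case: ifP => [/closed_rowP[] //|_]; case: ifP => // /metP[j].
  by rewrite leqn0 => /eqP ->; rewrite /symbols ic.
have hc : compatible (symbols c) 0 by [].
by apply: (accepted_from_prefix _ hc) => j jw; apply: (wc j.+1).
Qed.

Definition word_matrix r k (w : k.-tuple (symbol r)) : 'M[bool]_(r, k) :=
  \matrix_(i, j) (i \in val (tnth w j)).

Lemma column_segmentE r k (M : 'M[bool]_(r, k)) (c : nat -> {set 'I_r})
    (P : pred 'I_r) (y : 'I_k) :
  (forall i (j : 'I_k), M i j = (i \in c j)) ->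
  [forall i, P i ==> ~~ M i y] = ~~ [exists j in c y, P j].
Proof.
move=> Mc; rewrite negb_exists; apply: eq_forallb => i.
by rewrite Mc negb_and orbC implybE.
Qed.

Lemma row_prefixE r k (M : 'M[bool]_(r, k)) (c : nat -> {set 'I_r})
    (x : 'I_r) (y : 'I_k) :
  (forall i (j : 'I_k), M i j = (i \in c j)) ->
  [forall j : 'I_k, (j <= y) ==> ~~ M x j] = ~~ met c y x.
Proof.
move=> Mc; apply/forall_inP/negP => [h /metP[j jy]|h j jy].
  have jk : j < k by have := ltn_ord y; lia.
  by apply/negP; have := h (Ordinal jk) jy; rewrite Mc.
by rewrite Mc; apply/negP => xj; apply: h; apply/metP; exists j.
Qed.

Lemma row_suffixE r k (M : 'M[bool]_(r, k)) (c : nat -> {set 'I_r})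
    (x : 'I_r) (y : 'I_k) :
  (forall i (j : 'I_k), M i j = (i \in c j)) ->
  [forall j : 'I_k, (y <= j) ==> ~~ M x j] =
  [forall j : 'I_k, (y <= j) ==> (x \notin c j)].
Proof. by move=> Mc; apply: eq_forallb => j; rewrite Mc. Qed.

Lemma cw_pinwheel_okE r k (M : 'M[bool]_(r, k)) (c : nat -> {set 'I_r})
    (x x' : 'I_r) (y y' : 'I_k) :
  (forall i (j : 'I_k), M i j = (i \in c j)) -> y' = y.+1 :> nat ->
  cw_pinwheel_ok M x x' y y' =
  (cw_forces c y x x' ==> [forall j : 'I_k, (y' <= j) ==> (x' \notin c j)]).
Proof.
move=> Mc y'E; rewrite /cw_pinwheel_ok /cw_forces -y'E.
rewrite !(column_segmentE _ _ Mc) (row_prefixE _ _ Mc) (row_suffixE _ _ Mc).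
by rewrite implybE !negb_and -!orbA [_ || ~~ _]orbC.
Qed.

Lemma ccw_pinwheel_okE r k (M : 'M[bool]_(r, k)) (c : nat -> {set 'I_r})
    (x x' : 'I_r) (y y' : 'I_k) :
  (forall i (j : 'I_k), M i j = (i \in c j)) -> y' = y.+1 :> nat ->
  ccw_pinwheel_ok M x x' y y' =
  (ccw_forces c y x x' ==> [forall j : 'I_k, (y' <= j) ==> (x \notin c j)]).
Proof.
move=> Mc y'E; rewrite /ccw_pinwheel_ok /ccw_forces -y'E.
rewrite !(column_segmentE _ _ Mc) (row_prefixE _ _ Mc) (row_suffixE _ _ Mc).
by rewrite implybE !negb_and -!orbA [_ || ~~ _]orbC.
Qed.

(** A Baxter matrix meets a forced row only up to the forcing pinwheel, and it
    meets every row; so it has met that row by then, as [compatible] demands. *)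
Lemma baxter_compatible r n (M : 'M[bool]_(r, n.+1)) (c : nat -> symbol r) :
  (forall i (j : 'I_n.+1), M i j = (i \in symbols c j)) ->
  baxter_matrix M <->
  compatible (symbols c) n /\ forall i, met (symbols c) n i.
Proof.
move=> Mc.
have rowsE : [forall i : 'I_r, exists j : 'I_n.+1, M i j] <->
    forall i, met (symbols c) n i.
  split=> [/forallP rows i|rows]; last apply/forallP => i.
    by have /existsP[j] := rows i; rewrite Mc => ij; apply/existsP; exists j.
  by have /existsP[j ij] := rows i; apply/existsP; exists j; rewrite Mc.
have columns : [forall j : 'I_n.+1, exists i : 'I_r, M i j].
  apply/forallP => j; have [i ij] := set0Pn _ (valP (c j)).
  by apply/existsP; exists i; rewrite Mc.
rewrite /baxter_matrix columns andTb; split=> [/andP[/rowsE mt wheels]|[hc mt]].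
  split=> // y0 i y0n fi.
  have cl : forall j, y0 < j <= n -> i \notin symbols c j.
    have hy : y0 < n.+1 by lia.
    have {}wheels (x x' : 'I_r) : x' = x.+1 :> nat ->
        cw_pinwheel_ok M x x' (Ordinal hy) (Ordinal (y0n : y0.+1 < n.+1)) &&
        ccw_pinwheel_ok M x x' (Ordinal hy) (Ordinal (y0n : y0.+1 < n.+1)).
      move=> xx'; move: wheels.
      move=> /forallP/(_ x)/forallP/(_ x')/forallP/(_ (Ordinal hy)).
      by move=> /forallP/(_ (Ordinal (y0n : y0.+1 < n.+1))); rewrite xx' !eqxx.
    have close : [forall j : 'I_n.+1, (y0 < j) ==> (i \notin symbols c j)] ->
        forall j, y0 < j <= n -> i \notin symbols c j.
      move=> /forall_inP h j /andP[y0j jn].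
      by apply: (h (Ordinal (jn : j < n.+1))).
    apply: close; case/orP: fi => /existsP[x /andP[/eqP xi fi]].
      have /andP[+ _] := wheels _ _ xi.
      by rewrite (cw_pinwheel_okE _ _ Mc) // fi.
    have /andP[_] := wheels _ _ xi.
    by rewrite (ccw_pinwheel_okE _ _ Mc) // fi.
  split=> //; have /metP[j jn ij] := mt i; apply/metP; exists j => //.
  rewrite leqNgt; apply/negP => y0j.
  by move: (cl j); rewrite y0j jn ij => /(_ isT).
rewrite (introT idP (proj2 rowsE mt)) /=.
apply/forallP => x; apply/forallP => x'.
apply/forallP => y; apply/forallP => y'.
apply/implyP => /andP[/eqP xx' /eqP yy'].
have yn : y < n by have := ltn_ord y'; lia.
rewrite (cw_pinwheel_okE _ _ Mc) // (ccw_pinwheel_okE _ _ Mc) //.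
apply/andP; split; apply/implyP => fi; apply/forall_inP => j yj.
  have /(hc _ _ yn)[_] : newly_forced (symbols c) y x'.
    by apply/orP; left; apply/existsP; exists x; rewrite xx' eqxx.
  by apply; have := ltn_ord j; lia.
have /(hc _ _ yn)[_] : newly_forced (symbols c) y x.
  by apply/orP; right; apply/existsP; exists x'; rewrite xx' eqxx.
by apply; have := ltn_ord j; lia.
Qed.

Lemma baxter_word_matrix r n (w : n.+1.-tuple (symbol r)) :
  baxter_matrix (word_matrix w) = accepted None w.
Proof.
pose c j := nth (thead w) w j.
have Mc i (j : 'I_n.+1) : word_matrix w i j = (i \in symbols c j).
  by rewrite mxE (tnth_nth (thead w)).
have wc j : j < size w -> nth (c 0) w j = c j.
  by move=> jw; apply: set_nth_default.
have acc := accepted_compatible (size_tuple w) wc.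
have bax := baxter_compatible Mc.
by apply/idP/idP => [/bax|/acc]; [move/acc|move/bax].
Qed.

Lemma word_matrix_inj r k : injective (@word_matrix r k).
Proof.
move=> w w' /matrixP eqM; apply: eq_from_tnth => j; apply/val_inj/setP => i.
by have := eqM i j; rewrite !mxE.
Qed.

Lemma baxter_count_words r n :
  baxter_count r n.+1 = word_count (None : state r) n.+1.
Proof.
rewrite /baxter_count /word_count -(card_imset _ (@word_matrix_inj r n.+1)).
apply: eq_card => M; rewrite inE; apply/idP/imsetP => [bax|[w]]; last first.
  by rewrite inE -baxter_word_matrix => hw ->.
have col_neq0 (j : 'I_n.+1) : [set i | M i j] != set0.
  case/and3P: bax => _ /forallP /(_ j) /existsP[i ij] _.
  by apply/set0Pn; exists i; rewrite inE.
pose w :=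
  [tuple exist (fun c : {set 'I_r} => c != set0) _ (col_neq0 j) | j < n.+1].
have MW : M = word_matrix w.
  by apply/matrixP => i j; rewrite mxE tnth_mktuple inE.
by exists w; rewrite // inE -baxter_word_matrix -MW.
Qed.

(** * The polynomial *)

Local Open Scope ring_scope.

Definition path_term r l q : {poly rat} :=
  (path_count r l q)%:R * poly_binomial ('X - l%:R + q%:R - 1) q.-1.

Lemma baxter_poly_box r : (0 < r)%N -> baxter_poly r =
  \sum_(1 <= l < 2 * r) \sum_(1 <= q < 2 * r) path_term r l q.
Proof.
move=> r_gt0; pose I := index_iota 1 (2 * r).
rewrite /baxter_poly (fsbigE [seq (l, q) | l <- I, q <- I]) /=.
- rewrite big_mkcond big_allpairs_dep /=; apply: eq_big_seq => l.
  rewrite mem_index_iota => /andP[l_gt0 _]; apply: eq_big_seq => q.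
  rewrite mem_index_iota => /andP[q_gt0 _].
  by case: ifPn => // /negP[]; apply: mem_set.
- by rewrite allpairs_uniq ?iota_uniq // => -[a b] [c d].
- move=> _ /allpairsP[[l q] [+ + ->]] /=.
  by rewrite !mem_index_iota => /andP[l_gt0 _] /andP[q_gt0 _].
- move=> [l q] /= [l_gt0 q_gt0] notin_box.
  have -> : path_count r l q = 0%N; last by rewrite mul0r.
  apply: contraNeq notin_box => /path_count_neq0 /andP[le_ql le_l].
  by rewrite allpairs_f // mem_index_iota; apply/andP; split; lia.
Qed.

Lemma poly_binomial_factors (c : rat) n : poly_binomial ('X + c%:P) n =
  (n`!%:R)^-1 *: \prod_(i < n) ('X - (i%:R - c)%:P).
Proof.
congr (_ *: _); apply: eq_bigr => i _.
by rewrite polyCB opprB polyC_natr addrA addrAC.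
Qed.

Lemma path_termE r l q : (0 < q)%N -> path_term r l q =
  (path_count r l q)%:R *
  poly_binomial ('X + (q.-1%:R - l%:R : rat)%:P) q.-1.
Proof.
case: q => // q _; congr (_ * poly_binomial _ _).
by rewrite polyCB !polyC_natr /= -natr1; ring.
Qed.

Lemma size_path_term r l q : (0 < q)%N -> (size (path_term r l q) <= q)%N.
Proof.
move=> q_gt0; rewrite path_termE // mulr_natl -scaler_nat.
apply: leq_trans (size_scale_leq _ _) _.
rewrite poly_binomial_factors; apply: leq_trans (size_scale_leq _ _) _.
by rewrite size_prod_XsubC /index_enum -enumT size_enum_ord; case: q q_gt0.
Qed.

Lemma coef_path_term r l q :
  (path_term r l q.+1)`_q = (path_count r l q.+1)%:R / q`!%:R.
Proof.
rewrite path_termE // mulr_natl coefMn poly_binomial_factors coefZ /=.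
have szp : size (\prod_(i < q) ('X - (i%:R - (q%:R - l%:R : rat))%:P)) = q.+1.
  by rewrite size_prod_XsubC /index_enum -enumT size_enum_ord.
have monic_prod :
    \prod_(i < q) ('X - (i%:R - (q%:R - l%:R : rat))%:P) \is monic.
  exact: monic_prod_XsubC.
move/monicP: monic_prod; rewrite lead_coefE szp /= => ->.
by rewrite mulr1 mulr_natl.
Qed.

(** The product is a falling factorial of the natural number
    k - l + q - 1. *)
Lemma horner_path_term r l q k : (0 < q)%N -> (l <= k)%N ->
  (path_term r l q).[k%:R] = (path_count r l q * 'C(k - l + q - 1, q - 1))%:R.
Proof.
move=> q_gt0 le_lk; rewrite path_termE // mulr_natl hornerMn -mulr_natl natrM.
congr (_ * _); rewrite poly_binomial_factors hornerZ horner_prod.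
have -> : \prod_(i < q.-1) ('X - (i%:R - (q.-1%:R - l%:R))%:P).[k%:R : rat] =
    ((k - l + q - 1) ^_ q.-1)%:R.
  rewrite ffact_prod natr_prod; apply: eq_bigr => i _.
  have eqN : (k - l + q - 1 - i + (l + i) = k + q.-1)%N.
    by have := ltn_ord i; lia.
  rewrite hornerXsubC opprB addrA addrA -natrD -eqN !natrD.
  ring.
rewrite -bin_ffact natrM mulrC mulfK ?subn1 //.
by rewrite pnatr_eq0 -lt0n fact_gt0.
Qed.

(** Only q = 2r - 1 reaches this degree, and there the coefficient is the
    leading one. *)
Lemma coef_path_term_ge0 r l q : (0 < q < 2 * r)%N ->
  0 <= (path_term r l q)`_(2 * r - 2).
Proof.
move=> /andP[q_gt0 lt_q]; have [lt_q'|ge_q] := ltnP q (2 * r - 1).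
  by rewrite nth_default // (leq_trans (size_path_term _ _ q_gt0)) //; lia.
have -> : q = (2 * r - 2).+1 by lia.
by rewrite coef_path_term divr_ge0.
Qed.

Lemma size_baxter_poly r : (0 < r)%N -> size (baxter_poly r) = (2 * r - 2).+1%N.
Proof.
move=> r_gt0; apply/eqP; rewrite eqn_leq baxter_poly_box //; apply/andP; split.
  have size_add (p q : {poly rat}) n :
      (size p <= n)%N -> (size q <= n)%N -> (size (p + q)%R <= n)%N.
    by move=> hp hq; rewrite (leq_trans (size_polyD _ _)) // geq_max hp.
  rewrite big_nat_cond; elim/big_ind: _ => [|p q|l _].
    by rewrite size_poly0.
    exact: size_add.
  rewrite big_nat_cond; elim/big_ind: _ => [|p q|q].
    by rewrite size_poly0.
    exact: size_add.
  case/andP=> /andP[q_gt0 lt_q] _.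
  by rewrite (leq_trans (size_path_term _ _ q_gt0)) //; lia.
suff : 0 <
    (\sum_(1 <= l < 2 * r) \sum_(1 <= q < 2 * r)
      path_term r l q)`_(2 * r - 2).
  by rewrite ltnNge; apply: contraTN => /leq_sizeP ->.
have ge0 m l : (m <= 2 * r)%N ->
    0 <= (\sum_(1 <= q < m) path_term r l q)`_(2 * r - 2).
  move=> le_m; rewrite coef_sum big_nat_cond.
  rewrite sumr_ge0 // => q /andP[/andP[q0 qm] _].
  by apply: coef_path_term_ge0; lia.
have longest := path_count_longest_gt0 r_gt0.
pose d := (2 * r - 2)%N; have r2 : (2 * r = d.+2)%N by rewrite /d; lia.
move: longest ge0; rewrite -/d r2 subn1 /= => longest ge0.
rewrite big_nat_recr //= coefD ltr_wpDl //.
  by rewrite coef_sum sumr_ge0 // => l _; apply: ge0.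
rewrite big_nat_recr //= coefD ltr_wpDl //; first exact: ge0.
by rewrite coef_path_term divr_gt0 ?ltr0n ?fact_gt0.
Qed.

Theorem theorem5 (r : nat) (hr : (1 <= r)%N) :
  size (baxter_poly r) = (2 * r - 2).+1%N /\
  forall k : nat, (2 * r - 1 <= k)%N ->
    (baxter_count r k)%:R = (baxter_poly r).[k%:R].
Proof.
split=> [|[|k] hk]; first exact: size_baxter_poly; first by lia.
rewrite baxter_count_words word_count_box // baxter_poly_box //.
rewrite horner_sum natr_sum big_nat_cond [RHS]big_nat_cond.
apply: eq_bigr => l /andP[/andP[l_gt0 lt_l] _].
rewrite horner_sum natr_sum big_nat_cond [RHS]big_nat_cond.
apply: eq_bigr => q /andP[/andP[q_gt0 _] _].
by rewrite horner_path_term //; lia.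
Qed.
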